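(* There exists a computable function $\varphi:\mathbb{N}\times\mathbb{N}\to\mathbb{N}$ satisfying: (1) for all non-negative integers $n,l$, $\varphi(n,l)\leq l$; (2) for each non-negative integer $n$, $0=\varphi(n,0)<1=\varphi(n,1)\leq\varphi(n,2)\leq\varphi(n,3)\leq\ldots$; (3) for each non-negative integer $n$, the sequence $\{\varphi(n,l)\}_{l\in\mathbb{N}}$ is bounded from above; (4) the function $\theta:\mathbb{N}\to\mathbb{N}\setminus\{0\}$, $\theta(n)=\lim_{l\to\infty}\varphi(n,l)$, is strictly increasing and dominates all computable functions; (5) for each non-negative integer $n$, $\varphi(n,\theta(n)-1)<\theta(n)=\varphi(n,\theta(n))=\varphi(n,\theta(n)+1)=\varphi(n,\theta(n)+2)=\ldots$.
   Context: $\mathbb{N}$ denotes the set of non-negative integers. A function $\theta:\mathbb{N}\to\mathbb{N}$ dominates all computable functions if for every computable function $\Gamma:\mathbb{N}\to\mathbb{N}$ there exists $m\in\mathbb{N}$ such that $\Gamma(n)<\theta(n)$ for all $n\geq m$. *)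

(* Defs.v *)
From mathcomp Require Import all_boot.
From mathcomp Require Import classical_sets topology.

Set Implicit Arguments.
Unset Strict Implicit.
Unset Printing Implicit Defensive.

(* Kleene's mu-recursive functions, as syntax indexed by the arity.  In
   [MRec f g] the recursion variable is the first argument:
     h(0, v) = f(v),   h(k+1, v) = g(k, h(k, v), v);
   in [MMin f] the minimised variable is the first argument of [f]. *)
Inductive murec : nat -> Type :=
| MZero n : murec n
| MSucc : murec 1
| MProj n (i : 'I_n) : murec n
| MComp m n (f : murec m) (g : 'I_m -> murec n) : murec n
| MRec n (f : murec n) (g : murec n.+2) : murec n.+1
| MMin n (f : murec n.+1) : murec n.

Fixpoint primrec_graph (base : nat -> Prop) (step : nat -> nat -> nat -> Prop)
    (k y : nat) : Prop :=
  if k is k'.+1 then exists2 z, primrec_graph base step k' z & step k' z y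
  else base y.

(* The graph of the partial function denoted by a term: [murec_graph c v y]
   means that the function is defined at [v] with value [y].  For [MMin] all
   values before the first zero have to be defined and nonzero. *)
Fixpoint murec_graph n (c : murec n) : n.-tuple nat -> nat -> Prop :=
  match c in murec n return n.-tuple nat -> nat -> Prop with
  | MZero _ => fun _ y => y = 0
  | MSucc => fun v y => y = (thead v).+1
  | MProj _ i => fun v y => y = tnth v i
  | MComp m _ f g => fun v y =>
      exists2 w : m.-tuple nat,
        forall i, murec_graph (g i) v (tnth w i) & murec_graph f w y
  | MRec _ f g => fun v y =>
      primrec_graph (murec_graph f [tuple of behead v])
        (fun k z => murec_graph g [tuple of [:: k, z & behead v]])
        (thead v) y
  | MMin _ f => fun v y =>
      murec_graph f [tuple of y :: v] 0 /\
      forall k, k < y -> exists z, murec_graph f [tuple of k :: v] z.+1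
  end.

Definition computable n (F : n.-tuple nat -> nat) : Prop :=
  exists c : murec n, forall v y, murec_graph c v y <-> F v = y.

Definition computable1 (f : nat -> nat) : Prop :=
  computable (fun v : 1.-tuple nat => f (tnth v ord0)).

Definition computable2 (f : nat -> nat -> nat) : Prop :=
  computable (fun v : 2.-tuple nat => f (tnth v ord0) (tnth v ord_max)).

Definition dominates_computable (theta : nat -> nat) : Prop :=
  forall Gamma : nat -> nat, computable1 Gamma ->
    exists m, forall n, m <= n -> Gamma n < theta n.

(* Main.v *)
(* Arguments, stores and programs of a one-variable while language are coded
   as natural numbers, so that its one-step function is computable, and every
   mu-recursive function is compiled to a program of this language.  Let [h p]
   be the first time [t] at which the run from configuration [p] has halted
   with an output below [t], and [0] if there is none.  The function that is
   [0] at times before [h p] and [h p] afterwards is computable in [p] and the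
   time, even though [h] is not.  A maximum of finitely many such functions is
   at every time [l] at most [l] and reaches its limit exactly when [l] equals
   that limit; this is property (5).  Taking the maximum over a set of
   configurations that grows with [n] and eventually contains each program
   started on [n] gives domination, and delaying by [n.+1] makes the limit
   strictly increasing. *)

Require Import Defs.
From mathcomp Require Import all_boot.
From mathcomp Require Import boolp classical_sets topology.
From mathcomp Require Import zify.

Set Implicit Arguments.
Unset Strict Implicit.
Unset Printing Implicit Defensive.

Local Open Scope classical_set_scope.

(** * Closure properties of computable functions *)

Lemma computable_proj n (i : 'I_n) :
  computable (fun v : n.-tuple nat => tnth v i).
Proof. by exists (MProj i) => v y /=; split=> ->. Qed.

Lemma computable_zero n : computable (fun _ : n.-tuple nat => 0).
Proof. by exists (MZero n) => v y /=; split=> ->. Qed.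

Lemma computable_succ : computable (fun v : 1.-tuple nat => (thead v).+1).
Proof. by exists MSucc => v y /=; split=> ->. Qed.

Lemma computable_comp m n (F : m.-tuple nat -> nat)
    (G : 'I_m -> n.-tuple nat -> nat) :
  computable F -> (forall i, computable (G i)) ->
  computable (fun v => F [tuple G i v | i < m]).
Proof.
move=> [cf Hf] /choice[cg Hg]; exists (MComp cf cg) => v y /=; split.
  move=> [w Hw /Hf <-]; congr F; apply: eq_from_tnth => i.
  by rewrite tnth_mktuple; apply/Hg.
move=> <-; exists [tuple G i v | i < m]; last exact/Hf.
by move=> i; rewrite tnth_mktuple; apply/Hg.
Qed.

Lemma computable_rec n (B : n.-tuple nat -> nat) (S : n.+2.-tuple nat -> nat) :
  computable B -> computable S ->
  computable (fun v : n.+1.-tuple nat =>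
    iteri (thead v) (fun k z => S [tuple of [:: k, z & behead v]])
      (B [tuple of behead v])).
Proof.
move=> [cb Hb] [cs Hs]; exists (MRec cb cs) => v /=.
elim: (thead v) => [|k IHk] y /=; first exact: Hb.
split; first by move=> [z /IHk <- /Hs].
move=> Hy; exists (iteri k (fun k z => S [tuple of [:: k, z & behead v]])
  (B [tuple of behead v])); first exact/IHk.
exact/Hs.
Qed.

(* An argument list of any length is read through [nth 0], i.e. padded with
   zeros; this removes the arity from the closure properties below. *)
Definition seq_computable (F : seq nat -> nat) :=
  forall n, computable (fun v : n.-tuple nat => F v).

Lemma eq_computable n (F G : n.-tuple nat -> nat) :
  F =1 G -> computable F -> computable G.
Proof. by move=> FG [c Hc]; exists c => v y; rewrite -FG. Qed.

Lemma eq_seq_computable F G : F =1 G -> seq_computable F -> seq_computable G.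
Proof. by move=> FG CF n; apply: eq_computable (CF n) => v. Qed.

Lemma seq_computable_nth i : seq_computable (fun s => nth 0 s i).
Proof.
move=> n; case: (ltnP i n) => [lt_in | le_ni].
  apply: eq_computable (computable_proj (Ordinal lt_in)) => v.
  by rewrite (tnth_nth 0).
apply: eq_computable (computable_zero n) => v.
by rewrite nth_default ?size_tuple.
Qed.

Lemma seq_computable_comp F (Gs : seq (seq nat -> nat)) :
  seq_computable F -> (forall i, seq_computable (nth (fun=> 0) Gs i)) ->
  seq_computable (fun s => F [seq G s | G <- Gs]).
Proof.
move=> CF CG n.
apply: eq_computable (computable_comp (CF (size Gs)) (fun i => CG i n)) => v.
congr F; apply: (@eq_from_nth _ 0); rewrite size_tuple ?size_map // => i lt_i.
rewrite -[i]/(val (Ordinal lt_i)) -tnth_nth tnth_mktuple /=.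
by rewrite (nth_map (fun=> 0)).
Qed.

(** Prepending [K s] makes the count the head on which [computable_rec] recurses. In [S] the counter
    has index 0, the accumulator 1, and the original arguments start at 2. *)
Lemma seq_computable_rec K B S :
  seq_computable K -> seq_computable B -> seq_computable S ->
  seq_computable (fun s => iteri (K s) (fun k z => S [:: k, z & s]) (B s)).
Proof.
move=> CK CB CS n.
pose G (i : 'I_n.+1) (v : n.-tuple nat) := nth 0 (K v :: v) i.
have CG i : computable (G i).
  case: i => [[|i] lt_i]; first exact: CK.
  exact: seq_computable_nth.
apply: eq_computable (computable_comp (computable_rec (CB n) (CS n.+2)) CG) => v.
have -> : [tuple G i v | i < n.+1] = [tuple of K v :: v].
  by apply: eq_from_tnth => i; rewrite tnth_mktuple (tnth_nth 0).
by rewrite theadE.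
Qed.

Lemma seq_computable_fun1 (f : nat -> nat) F :
  seq_computable (fun s => f (nth 0 s 0)) -> seq_computable F ->
  seq_computable (fun s => f (F s)).
Proof.
move=> Cf CF; apply: (seq_computable_comp (Gs := [:: F]) Cf) => -[|i] //=.
by rewrite nth_nil => n; apply: computable_zero.
Qed.

Lemma seq_computable_fun2 (f : nat -> nat -> nat) F G :
  seq_computable (fun s => f (nth 0 s 0) (nth 0 s 1)) ->
  seq_computable F -> seq_computable G ->
  seq_computable (fun s => f (F s) (G s)).
Proof.
move=> Cf CF CG.
apply: (seq_computable_comp (Gs := [:: F; G]) Cf) => -[|[|i]] //=.
by rewrite nth_nil => n; apply: computable_zero.
Qed.

Lemma seq_computable_succ F :
  seq_computable F -> seq_computable (fun s => (F s).+1).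
Proof.
move=> CF n.
apply: eq_computable (computable_comp computable_succ (fun=> CF n)) => v.
by rewrite /thead tnth_mktuple.
Qed.

Lemma seq_computable_const c : seq_computable (fun=> c).
Proof.
elim: c => [n|c IHc]; [exact: computable_zero | exact: seq_computable_succ].
Qed.

#[local] Hint Resolve seq_computable_nth seq_computable_const
  seq_computable_succ : computability.
Ltac computability := auto 100 with computability.

Lemma seq_computable_add F G :
  seq_computable F -> seq_computable G -> seq_computable (fun s => F s + G s).
Proof.
apply: seq_computable_fun2.
apply: (eq_seq_computable
  (F := fun s => iteri (nth 0 s 1) (fun k z => z.+1) (nth 0 s 0))).
  by move=> s; elim: (nth 0 s 1) => [|k IHk] /=; rewrite ?addn0 // IHk addnS.
by apply: (seq_computable_rec (S := fun s => (nth 0 s 1).+1)); computability.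
Qed.

Lemma seq_computable_pred F :
  seq_computable F -> seq_computable (fun s => (F s).-1).
Proof.
apply: seq_computable_fun1.
apply: (eq_seq_computable (F := fun s => iteri (nth 0 s 0) (fun k _ => k) 0)).
  by move=> s; case: (nth 0 s 0).
by apply: (seq_computable_rec (S := fun s => nth 0 s 0)); computability.
Qed.

#[local] Hint Resolve seq_computable_add seq_computable_pred : computability.

Lemma seq_computable_sub F G :
  seq_computable F -> seq_computable G -> seq_computable (fun s => F s - G s).
Proof.
apply: seq_computable_fun2.
apply: (eq_seq_computable
  (F := fun s => iteri (nth 0 s 1) (fun k z => z.-1) (nth 0 s 0))).
  by move=> s; elim: (nth 0 s 1) => [|k IHk] /=; rewrite ?subn0 // IHk subnS.
by apply: (seq_computable_rec (S := fun s => (nth 0 s 1).-1)); computability.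
Qed.

Lemma seq_computable_mul F G :
  seq_computable F -> seq_computable G -> seq_computable (fun s => F s * G s).
Proof.
apply: seq_computable_fun2.
apply: (eq_seq_computable
  (F := fun s => iteri (nth 0 s 1) (fun k z => nth 0 s 0 + z) 0)).
  by move=> s; elim: (nth 0 s 1) => [|k IHk] /=; rewrite ?muln0 // IHk mulnS.
by apply: (seq_computable_rec (S := fun s => nth 0 s 2 + nth 0 s 1));
  computability.
Qed.

#[local] Hint Resolve seq_computable_sub seq_computable_mul : computability.

Lemma seq_computable_max F G :
  seq_computable F -> seq_computable G ->
  seq_computable (fun s => maxn (F s) (G s)).
Proof.
move=> CF CG; apply: (eq_seq_computable (F := fun s => F s + (G s - F s))).
  by move=> s; rewrite maxnE.
by computability.
Qed.

Lemma seq_computable_min F G :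
  seq_computable F -> seq_computable G ->
  seq_computable (fun s => minn (F s) (G s)).
Proof.
move=> CF CG; apply: (eq_seq_computable (F := fun s => F s - (F s - G s))).
  by move=> s; rewrite minnE.
by computability.
Qed.

Lemma seq_computable_if (P : seq nat -> bool) F G :
  seq_computable P -> seq_computable F -> seq_computable G ->
  seq_computable (fun s => if P s then F s else G s).
Proof.
move=> CP CF CG.
apply: (eq_seq_computable (F := fun s => P s * F s + (1 - P s) * G s)).
  by move=> s; case: (P s); rewrite /= ?mul1n ?mul0n ?addn0.
by computability.
Qed.

Lemma seq_computable_leq F G :
  seq_computable F -> seq_computable G ->
  seq_computable (fun s => F s <= G s).
Proof.
move=> CF CG; apply: (eq_seq_computable (F := fun s => 1 - (F s - G s))).
  by move=> s; lia.
by computability.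
Qed.

#[local] Hint Resolve seq_computable_max seq_computable_min seq_computable_if
  seq_computable_leq : computability.

Lemma seq_computable_eqn F G :
  seq_computable F -> seq_computable G ->
  seq_computable (fun s => F s == G s).
Proof.
move=> CF CG.
apply: (eq_seq_computable (F := fun s => (F s <= G s) * (G s <= F s))).
  by move=> s; lia.
by computability.
Qed.

Lemma seq_computable_andb (P Q : seq nat -> bool) :
  seq_computable P -> seq_computable Q ->
  seq_computable (fun s => P s && Q s).
Proof.
move=> CP CQ; apply: (eq_seq_computable (F := fun s => P s * Q s)).
  by move=> s; rewrite mulnb.
by computability.
Qed.

#[local] Hint Resolve seq_computable_eqn seq_computable_andb : computability.

(** * Pairing by integer square roots *)

Definition isqrt z :=
  iteri z (fun k r => if r.+1 * r.+1 <= k.+1 then r.+1 else r) 0.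

Lemma isqrtP z : isqrt z * isqrt z <= z < (isqrt z).+1 * (isqrt z).+1.
Proof.
rewrite /isqrt; elim: z => //= z.
set r := iteri _ _ _; case: ifP; nia.
Qed.

(** The value stays below the square of [(x + y).+1], so [isqrt] recovers [x + y]. *)
Definition npair x y := (x + y) * (x + y) + y.
Definition nsnd z := z - isqrt z * isqrt z.
Definition nfst z := isqrt z - nsnd z.

Lemma isqrt_npair x y : isqrt (npair x y) = x + y.
Proof. by have := isqrtP (npair x y); rewrite /npair; nia. Qed.

Lemma nsnd_pair x y : nsnd (npair x y) = y.
Proof. by rewrite /nsnd isqrt_npair /npair addKn. Qed.

Lemma nfst_pair x y : nfst (npair x y) = x.
Proof. by rewrite /nfst isqrt_npair nsnd_pair addnK. Qed.

Definition npairK := (nfst_pair, nsnd_pair).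

Lemma leq_npair x x' y y' : x <= x' -> y <= y' -> npair x y <= npair x' y'.
Proof. by rewrite /npair; nia. Qed.

Lemma seq_computable_isqrt F :
  seq_computable F -> seq_computable (fun s => isqrt (F s)).
Proof.
apply: seq_computable_fun1.
apply: (seq_computable_rec (S := fun s =>
  if (nth 0 s 1).+1 * (nth 0 s 1).+1 <= (nth 0 s 0).+1
  then (nth 0 s 1).+1 else nth 0 s 1)); by computability.
Qed.

#[local] Hint Resolve seq_computable_isqrt : computability.

Lemma seq_computable_npair F G :
  seq_computable F -> seq_computable G ->
  seq_computable (fun s => npair (F s) (G s)).
Proof. by rewrite /npair; computability. Qed.

Lemma seq_computable_nsnd F :
  seq_computable F -> seq_computable (fun s => nsnd (F s)).
Proof. by rewrite /nsnd; computability. Qed.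

#[local] Hint Resolve seq_computable_npair seq_computable_nsnd : computability.

Lemma seq_computable_nfst F :
  seq_computable F -> seq_computable (fun s => nfst (F s)).
Proof. by rewrite /nfst; computability. Qed.

#[local] Hint Resolve seq_computable_nfst : computability.
#[local] Opaque npair nfst nsnd.

(** * A universal machine *)

Declare Scope stack_scope.
Notation "x ;; y" := (npair x y) (at level 55, right associativity)
  : stack_scope.
Local Open Scope stack_scope.

(* The store is a single number read as a stack [a ;; b ;; c ;; rest]. *)
Definition primitives : seq (nat -> nat) :=
  [:: (* 0 : e ;; r => 0 ;; r *)
      fun x => 0 ;; nsnd x;
      (* 1 : (a ;; e) ;; r => a.+1 ;; r *)
      fun x => (nfst (nfst x)).+1 ;; nsnd x;
      (* 2 : (a ;; e) ;; r => e ;; r *)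
      fun x => nsnd (nfst x) ;; nsnd x;
      (* 3 : (a ;; e) ;; r => a ;; r *)
      fun x => nfst (nfst x) ;; nsnd x;
      (* 4 : r => 0 ;; r *)
      fun x => 0 ;; x;
      (* 5 : w ;; e ;; r => e ;; w ;; e ;; r *)
      fun x => nfst (nsnd x) ;; x;
      (* 6 : a ;; w ;; r => (a ;; w) ;; r *)
      fun x => (nfst x ;; nfst (nsnd x)) ;; nsnd (nsnd x);
      (* 7 : w ;; e ;; r => w ;; r *)
      fun x => nfst x ;; nsnd (nsnd x);
      (* 8 : (k ;; e) ;; r => e ;; k ;; 0 ;; e ;; r *)
      fun x => nsnd (nfst x) ;; nfst (nfst x) ;; 0 ;; nsnd (nfst x) ;; nsnd x;
      (* 9 : z ;; k ;; j ;; r => k ;; j ;; z ;; r *)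
      fun x => nfst (nsnd x) ;; nfst (nsnd (nsnd x)) ;; nfst x
               ;; nsnd (nsnd (nsnd x));
      (* 10 : k ;; j ;; z ;; e ;; r
              => (j ;; z ;; e) ;; k.-1 ;; j.+1 ;; e ;; r *)
      fun x => (nfst (nsnd x) ;; nfst (nsnd (nsnd x))
                ;; nfst (nsnd (nsnd (nsnd x))))
               ;; (nfst x).-1 ;; (nfst (nsnd x)).+1 ;; nsnd (nsnd (nsnd x));
      (* 11 : k ;; j ;; z ;; e ;; r => z ;; r *)
      fun x => nfst (nsnd (nsnd x)) ;; nsnd (nsnd (nsnd (nsnd x)));
      (* 12 : e ;; r => (0 ;; e) ;; 0 ;; e ;; r *)
      fun x => (0 ;; nfst x) ;; 0 ;; x;
      (* 13 : t ;; j ;; e ;; r => (j.+1 ;; e) ;; j.+1 ;; e ;; r *)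
      fun x => ((nfst (nsnd x)).+1 ;; nfst (nsnd (nsnd x)))
               ;; (nfst (nsnd x)).+1 ;; nsnd (nsnd x);
      (* 14 : t ;; j ;; e ;; r => j ;; r *)
      fun x => nfst (nsnd x) ;; nsnd (nsnd (nsnd x))].

Definition prim j := npair 0 j.
(** The index lies beyond the list, where [nth] returns its default [id]. *)
Definition skip := prim (size primitives).
Definition pseq a b := npair 1 (npair a b).
Definition loop a := npair 2 a.

(* A continuation is a list of programs still to be run, with [0] as the
   empty list; a configuration is a continuation paired with a store. *)
Definition push a k := (npair a k).+1.

(** A loop tests the top of the store; to repeat, it pushes its body onto the unchanged
    continuation, whose head is the loop itself. *)
Definition step z :=
  if nfst z == 0 then z else
  let k := (nfst z).-1 in
  let x := nsnd z in
  let arg := nsnd (nfst k) in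
  if nfst (nfst k) == 0 then nsnd k ;; nth id primitives arg x else
  if nfst (nfst k) == 1 then push (nfst arg) (push (nsnd arg) (nsnd k)) ;; x
  else if nfst x == 0 then nsnd k ;; x else push arg (nfst z) ;; x.

Lemma step_halted z : nfst z = 0 -> step z = z.
Proof. by rewrite /step => ->. Qed.

Lemma step_prim j k x :
  step (push (prim j) k ;; x) = k ;; nth id primitives j x.
Proof. by rewrite /step /push !(npairK, succnK) /= ?npairK. Qed.

Lemma step_pseq a b k x :
  step (push (pseq a b) k ;; x) = push a (push b k) ;; x.
Proof. by rewrite /step /push !(npairK, succnK) /= ?npairK. Qed.

Lemma step_loop a k x :
  step (push (loop a) k ;; x)
  = (if nfst x == 0 then k else push a (push (loop a) k)) ;; x.
Proof. by rewrite /step /push !(npairK, succnK) /= ?npairK; case: ifP. Qed.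

(** One number of steps serves every continuation, so runs of subprograms can be chained. *)
Definition exec c x y :=
  exists t, forall k, iter t step (push c k ;; x) = k ;; y.

Lemma exec_prim j x y : nth id primitives j x = y -> exec (prim j) x y.
Proof. by move=> <-; exists 1 => k; apply: step_prim. Qed.

Lemma exec_skip x : exec skip x x.
Proof. exact: exec_prim. Qed.

Lemma exec_pseq a b x y z : exec a x y -> exec b y z -> exec (pseq a b) x z.
Proof.
move=> [t Ht] [t' Ht']; exists (t' + t).+1 => k.
by rewrite iterSr step_pseq iterD Ht Ht'.
Qed.

Lemma exec_loop_stop a x : nfst x = 0 -> exec (loop a) x x.
Proof. by move=> x0; exists 1 => k; rewrite /= step_loop x0. Qed.

Lemma exec_loop_next a x y z :
  nfst x != 0 -> exec a x y -> exec (loop a) y z -> exec (loop a) x z.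
Proof.
move=> /negbTE x0 [t Ht] [t' Ht']; exists (t' + t).+1 => k.
by rewrite iterSr step_loop x0 iterD Ht Ht'.
Qed.

(** * Compiling mu-recursive terms *)

Fixpoint compile n (c : murec n) : nat :=
  match c with
  | MZero _ => prim 0
  | MSucc => prim 1
  | MProj _ i => pseq (iter i (pseq (prim 2)) skip) (prim 3)
  | MComp m _ f g =>
      pseq (prim 4)
        (* From the last index to the first, [g i] is run on a copy of the arguments and its value
           is put onto the stack of results. *)
        (pseq (foldr (fun i a =>
                 pseq a (pseq (prim 5) (pseq (compile (g i)) (prim 6))))
                 skip (enum 'I_m))
          (pseq (prim 7) (compile f)))
  | MRec _ f g =>
      pseq (prim 8) (pseq (compile f) (pseq (prim 9)
        (pseq (loop (pseq (prim 10) (pseq (compile g) (prim 9)))) (prim 11))))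
  | MMin _ f =>
      pseq (prim 12) (pseq (compile f)
        (pseq (loop (pseq (prim 13) (compile f))) (prim 14)))
  end.

Definition stack_of (s : seq nat) := foldr npair 0 s.

Ltac exec_prim := by apply: exec_prim; rewrite /= ?npairK.

Lemma exec_proj i s r : i < size s ->
  exec (pseq (iter i (pseq (prim 2)) skip) (prim 3))
    (stack_of s ;; r) (nth 0 s i ;; r).
Proof.
move=> lt_is; suff Htl : exec (iter i (pseq (prim 2)) skip)
    (stack_of s ;; r) (stack_of (drop i s) ;; r).
  apply: (exec_pseq Htl); rewrite (drop_nth 0 lt_is) /=; exec_prim.
elim: i s lt_is => [|i IHi] [|a s] //= lt_is; first exact: exec_skip.
apply: (exec_pseq _ (IHi s lt_is)); exec_prim.
Qed.

Lemma compileP n (c : murec n) (v : n.-tuple nat) y r :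
  murec_graph c v y -> exec (compile c) (stack_of v ;; r) (y ;; r).
Proof.
elim: c v y r => {n} [n|| n i | m n f IHf g IHg | n f IHf g IHg | n f IHf] v y r.
- by move=> /= ->; exec_prim.
- by case/tupleP: v => a v /= ->; rewrite theadE; exec_prim.
- move=> /= ->; rewrite (tnth_nth 0); apply: exec_proj.
  by rewrite size_tuple.
- move=> /= [w Hw Hy]; apply: (exec_pseq (y := 0 ;; stack_of v ;; r)).
    exec_prim.
  apply: (exec_pseq (y := stack_of w ;; stack_of v ;; r)); last first.
    by apply: exec_pseq (IHf _ _ _ Hy); exec_prim.
  rewrite -(map_tnth_enum w).
  elim: (enum 'I_m) => [|i l IHl] /=; first exact: exec_skip.
  apply: exec_pseq IHl _.
  apply: (exec_pseq (y := stack_of v ;; _ ;; stack_of v ;; r)); first exec_prim.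
  by apply: exec_pseq (IHg _ _ _ _ (Hw i)) _; exec_prim.
- case/tupleP: v => k v /=; rewrite theadE.
  set base := murec_graph f _; set next := fun k z => _.
  have -> : base = murec_graph f v by congr murec_graph; apply: val_inj.
  have -> : next = fun j z => murec_graph g [tuple of [:: j, z & v]].
    by apply/funext => j; apply/funext => z; congr murec_graph; apply: val_inj.
  (* Loop state: [d] rounds left, [j] rounds done, current value [z]. *)
  set body := pseq (prim 10) _; pose W d j z := d ;; j ;; z ;; stack_of v ;; r.
  move=> {base next} Hk.
  (* A run from the state after [k] rounds extends back to the initial state; [d] is general because
     the induction on [k] raises it by one. *)
  have {Hk} : exists2 z0, murec_graph f v z0 & forall d out,
      exec (loop body) (W d k y) out -> exec (loop body) (W (k + d) 0 z0) out.
    elim: k y Hk => [|k IHk] y /=; first by exists y.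
    move=> [z /IHk[z0 Hz0 Hloop] Hy]; exists z0 => // d out Hout.
    rewrite addSnnS; apply: Hloop.
    apply: exec_loop_next Hout; first by rewrite npairK.
    apply: (exec_pseq (y := (k ;; z ;; stack_of v) ;; d ;; k.+1
                            ;; stack_of v ;; r)); first exec_prim.
    by apply: exec_pseq (IHg _ _ _ Hy) _; exec_prim.
  move=> [z0 Hz0 Hloop].
  apply: (exec_pseq (y := stack_of v ;; k ;; 0 ;; stack_of v ;; r)).
    exec_prim.
  apply: exec_pseq (IHf _ _ _ Hz0) _.
  apply: (exec_pseq (y := W k 0 z0)); first exec_prim.
  apply: (exec_pseq (y := W 0 k y)); last exec_prim.
  rewrite -{1}[k]addn0; apply: Hloop; apply: exec_loop_stop.
  by rewrite npairK.
- move=> /= [Hy Hlt]; set body := pseq (prim 13) _.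
  (* [d] is the distance from [j] to the minimiser, so the induction goes down from [y], where the
     loop stops. *)
  have Hloop d j : j + d = y -> exists2 t,
      murec_graph f [tuple of j :: v] t &
      exec (loop body) (t ;; j ;; stack_of v ;; r) (0 ;; y ;; stack_of v ;; r).
    elim: d j => [|d IHd] j.
      rewrite addn0 => ->; exists 0 => //.
      by apply: exec_loop_stop; rewrite npairK.
    rewrite -addSnnS => Hj; have [t Ht Hexec] := IHd _ Hj.
    have [|z Hz] := Hlt j; first by rewrite -Hj leq_addr.
    exists z.+1 => //; apply: exec_loop_next Hexec; first by rewrite npairK.
    by apply: exec_pseq (IHf _ _ _ Ht); exec_prim.
  have [t Ht Hexec] := Hloop y 0 erefl.
  apply: (exec_pseq (y := stack_of (0 :: v) ;; 0 ;; stack_of v ;; r)).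
    exec_prim.
  apply: exec_pseq (IHf _ _ _ Ht) _.
  by apply: exec_pseq Hexec _; exec_prim.
Qed.

(** * Computability of the simulation *)

Lemma seq_computable_nth_fun (fs : seq (nat -> nat)) J F :
  (forall i, seq_computable (fun s => nth id fs i (nth 0 s 0))) ->
  seq_computable J -> seq_computable F ->
  seq_computable (fun s => nth id fs (J s) (F s)).
Proof.
move=> Cfs CJ CF; elim: fs Cfs J CJ => [|f fs IHfs] Cfs J CJ.
  by apply: eq_seq_computable CF => s; rewrite nth_nil.
have Cf := seq_computable_fun1 (Cfs 0) CF.
have Ctl := IHfs (fun i => Cfs i.+1) _ (seq_computable_pred CJ).
apply: (eq_seq_computable
  (F := fun s => if J s == 0 then f (F s) else nth id fs (J s).-1 (F s))).
  by move=> s; case: (J s).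
by computability.
Qed.

Lemma seq_computable_step F :
  seq_computable F -> seq_computable (fun s => step (F s)).
Proof.
move=> CF; rewrite /step /push.
have Cprim : seq_computable (fun s =>
    nth id primitives (nsnd (nfst (nfst (F s)).-1)) (nsnd (F s))).
  apply: seq_computable_nth_fun; try by computability.
  (* One case for each of the 15 primitives; every further index gives [id]. *)
  move=> i; do 15?[case: i => [|i]; first by rewrite /=; computability].
  by rewrite /= nth_nil; computability.
by computability.
Qed.

Lemma seq_computable_iter_step T F :
  seq_computable T -> seq_computable F ->
  seq_computable (fun s => iter (T s) step (F s)).
Proof.
move=> CT CF.
apply: (eq_seq_computable (F := fun s => iteri (T s) (fun _ => step) (F s))).
  by move=> s; elim: (T s) => //= t ->.
apply: (seq_computable_rec (S := fun s => step (nth 0 s 1))) => //.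
by apply: seq_computable_step; computability.
Qed.

#[local] Hint Resolve seq_computable_iter_step : computability.

(** * Halting times as limits *)

Definition halts_below p t :=
  (nfst (iter t step p) == 0) && (nfst (nsnd (iter t step p)) < t).

Lemma iter_halted p t u : nfst (iter t step p) = 0 -> t <= u ->
  iter u step p = iter t step p.
Proof.
move=> Ht /subnK <-; rewrite iterD.
by elim: (u - t) => //= d ->; apply: step_halted.
Qed.

Definition stage p l :=
  iteri l (fun k z =>
    if z == 0 then if halts_below p k.+1 then k.+1 else 0 else z) 0.

(** [t] is the least time that qualifies, or 0 if there is none; excluded middle decides which. *)
Lemma stageP p : exists t,
  (forall l, stage p l = if t <= l then t else 0) /\
  (forall u, halts_below p u -> halts_below p t).
Proof.
have [Hex | Hnex] := pselect (exists u, halts_below p u); last first.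
  exists 0; split=> [l | u Hu]; last by case: Hnex; exists u.
  rewrite /stage; elim: l => //= l ->; case: ifP => // Hl.
  by case: Hnex; exists l.+1.
case: (ex_minnP Hex) => t Ht min_t; exists t; split=> // l.
(* No output is below 0, so [stage] may test positive times only and use 0 for not found. *)
have t_gt0 : 0 < t by move: Ht => /andP[_]; case: (t).
rewrite /stage; elim: l => [|l /= ->]; first by rewrite /= leqNgt t_gt0.
case: (leqP t l) => [le_tl | lt_lt]; first by rewrite leqW //; case: (t) t_gt0.
rewrite eqxx; case: ifP => [/min_t le_t | Hl]; first by rewrite le_t; lia.
case: ifP => // le_t; have tE : l.+1 = t by lia.
by move: Hl; rewrite tE Ht.
Qed.

Definition start c n := push c 0 ;; stack_of [:: n] ;; 0.

Lemma exec_halts_below c n y :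
  exec c (stack_of [:: n] ;; 0) (y ;; 0) ->
  exists u, halts_below (start c n) u.
Proof.
move=> [t /(_ 0) Ht]; exists (maxn t y.+1); rewrite /halts_below.
have E := iter_halted (p := start c n) (t := t) (u := maxn t y.+1).
by rewrite E ?Ht ?npairK ?leq_maxl // leq_maxr.
Qed.

Lemma exec_halts_below_val c n y t :
  exec c (stack_of [:: n] ;; 0) (y ;; 0) ->
  halts_below (start c n) t -> y < t.
Proof.
move=> [t' /(_ 0) Ht'] /andP[/eqP Ht].
(* Halted configurations are frozen, so the times [t] and [t'] show the same output. *)
suff -> : iter t step (start c n) = (0 ;; y ;; 0) by rewrite !npairK.
have [le_tt' | /ltnW le_t't] := leqP t t'.
  by rewrite -(iter_halted Ht le_tt') Ht'.
by rewrite (iter_halted _ le_t't) ?Ht' ?npairK.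
Qed.

(* Bounds [start c n] for every program with [push c 0 <= n]. *)
Definition config_bound n := (n ;; stack_of [:: n] ;; 0).+1.

Lemma leq_config_bound m n : m <= n -> config_bound m <= config_bound n.
Proof. by move=> le_mn; rewrite ltnS !leq_npair. Qed.

Lemma start_lt_bound c n : push c 0 <= n -> start c n < config_bound n.
Proof. by move=> le_cn; rewrite ltnS leq_npair. Qed.

(** * The function [phi] and its limit *)

Definition max_stage n l := \max_(p < config_bound n) stage p l.

(** Up to time [n.+1] the value is [l] itself, which gives the values 0 and 1; only then does the
    maximum start. *)
Definition phi n l := minn l n.+1 + max_stage n (l - n.+1).

Lemma seq_computable_stage P L :
  seq_computable P -> seq_computable L ->
  seq_computable (fun s => stage (P s) (L s)).
Proof.
apply: seq_computable_fun2; rewrite /stage.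
apply: (seq_computable_rec (S := fun s => if nth 0 s 1 == 0 then
  if halts_below (nth 0 s 2) (nth 0 s 0).+1 then (nth 0 s 0).+1 else 0
  else nth 0 s 1)); try by computability.
by rewrite /halts_below; computability.
Qed.

Lemma seq_computable_max_stage N L :
  seq_computable N -> seq_computable L ->
  seq_computable (fun s => max_stage (N s) (L s)).
Proof.
apply: seq_computable_fun2; rewrite /max_stage.
apply: (eq_seq_computable (F := fun s => iteri (config_bound (nth 0 s 0))
  (fun p z => maxn z (stage p (nth 0 s 1))) 0)).
  move=> s; elim: (config_bound _) => [|b /= ->]; first by rewrite big_ord0.
  by rewrite big_ord_recr.
apply: (seq_computable_rec
  (S := fun s => maxn (nth 0 s 1) (stage (nth 0 s 0) (nth 0 s 3)))).
- by rewrite /config_bound /=; computability.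
- by computability.
- by apply: seq_computable_max; last apply: seq_computable_stage; computability.
Qed.

Lemma computable2_phi : computable2 phi.
Proof.
have Cphi : seq_computable (fun s => phi (nth 0 s 0) (nth 0 s 1)).
  rewrite /phi; apply: seq_computable_add; first by computability.
  by apply: seq_computable_max_stage; computability.
by apply: eq_computable (Cphi 2) => v; rewrite !(tnth_nth 0).
Qed.

Theorem theorem3 :
  exists phi : nat -> nat -> nat,
    computable2 phi /\
    (forall n l, phi n l <= l) /\
    (forall n, phi n 0 = 0 /\ phi n 1 = 1 /\
       forall l, 1 <= l -> phi n l <= phi n l.+1) /\
    (forall n, exists M, forall l, phi n l <= M) /\
    exists theta : nat -> nat,
      (forall n, 0 < theta n) /\
      (forall n, phi n l @[l --> \oo] --> theta n) /\
      (forall m n, m < n -> theta m < theta n) /\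
      dominates_computable theta /\
      (forall n, phi n (theta n - 1) < theta n /\
         forall k, phi n (theta n + k) = theta n).
Proof.
have [h Hh] := choice stageP.
have stageE p l : stage p l = if h p <= l then h p else 0 by case: (Hh p).
(* The limit of [max_stage n], since [stage p] is constant from time [h p] on. *)
pose hmax n := \max_(p < config_bound n) h p.
have max_stage_le n l : max_stage n l <= l.
  by apply/bigmax_leqP => p _; rewrite stageE; case: ifP.
have max_stage_mono n k l : k <= l -> max_stage n k <= max_stage n l.
  move=> le_kl; apply/bigmax_leqP => p _.
  apply: leq_trans (leq_bigmax p); rewrite !stageE.
  by case: ifP => // /leq_trans/(_ le_kl) ->.
have max_stage_lim n l : hmax n <= l -> max_stage n l = hmax n.
  move=> le_hl; apply: eq_bigr => p _; rewrite stageE.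
  by rewrite (leq_trans (leq_bigmax p) le_hl).
have phi_le n l : phi n l <= l.
  by rewrite /phi; have := max_stage_le n (l - n.+1); lia.
have phi_mono n k l : k <= l -> phi n k <= phi n l.
  move=> le_kl; rewrite /phi.
  have := max_stage_mono n (k - n.+1) (l - n.+1); lia.
pose theta n := n.+1 + hmax n.
have phi_lim n k : phi n (theta n + k) = theta n.
  rewrite /phi max_stage_lim /theta; lia.
exists phi; split; first exact: computable2_phi.
split=> //; split.
  move=> n; split; first by have := phi_le n 0; lia.
  split=> [|l _]; last exact: phi_mono.
  by have := phi_le n 1; rewrite /phi; lia.
split.
  by move=> n; exists (theta n) => l; rewrite -(phi_lim n l) phi_mono ?leq_addl.
exists theta; split=> //; split; [|split; [|split]].
- move=> n; apply: cvg_near_cst; exists (theta n) => // l /= /subnKC <-.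
  exact: phi_lim.
(* The summand [n.+1] supplies the strictness. *)
- move=> m n lt_mn; suff : hmax m <= hmax n by rewrite /theta; lia.
  apply/bigmax_leqP => p _.
  have lt_p : p < config_bound n.
    exact: leq_trans (ltn_ord p) (leq_config_bound (ltnW lt_mn)).
  exact: (leq_bigmax (Ordinal lt_p)).
(* From this [n] on, the program for [Gamma] started on [n] is coded below [config_bound n], so its
   halting time, which exceeds [Gamma n], enters [hmax n]. *)
- move=> Gamma [c Hc]; exists (push (compile c) 0) => n le_n.
  have Hexec : exec (compile c) (stack_of [:: n] ;; 0) (Gamma n ;; 0).
    by apply: (compileP (v := [tuple n])); apply/Hc.
  have [u Hu] := exec_halts_below Hexec.
  have [_ /(_ u Hu) Hp] := Hh (start (compile c) n).
  have lt_h := exec_halts_below_val Hexec Hp.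
  have le_h := leq_bigmax (F := fun p : 'I_(config_bound n) => h p)
    (Ordinal (start_lt_bound le_n)).
  by rewrite /theta ltn_addl // (leq_trans lt_h).
- move=> n; split; last exact: phi_lim.
  (* Positivity makes [theta n - 1] a genuine predecessor, and [phi n l <= l] then suffices. *)
  have theta_gt0 : 0 < theta n by [].
  by have := phi_le n (theta n - 1); lia.
Qed.
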